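(* Let $n$ be an odd perfect number with prime factorization $n=\prod_{p\mid n}p^{h_p}$, where the product runs over the distinct primes $p$ dividing $n$ and $h_p\ge 1$ is the exponent of $p$ in $n$. Let $\alpha$ be a positive integer such that $\alpha\le h_p$ for every prime $p\mid n$. Then $$\frac{2^{\alpha+2}}{\zeta(\alpha+1)\,(2^{\alpha+1}-1)} \;<\; \prod_{p\mid n}\ \sum_{i=0}^{\alpha}p^{-i} \;<\; 2,$$ where the product is over all primes $p$ dividing $n$.
   Context: A positive integer $n$ is perfect if $\sigma(n)=2n$, where $\sigma(n)$ denotes the sum of all positive divisors of $n$; an odd perfect number is an odd positive integer that is perfect. $\zeta(s)$ denotes the Riemann zeta function. *)

(* Defs.v *)
From mathcomp Require Import all_boot all_order all_algebra.
From mathcomp Require Import all_classical all_reals all_analysis.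

Set Implicit Arguments.
Unset Strict Implicit.
Unset Printing Implicit Defensive.

Import numFieldNormedType.Exports.

Definition sigma (n : nat) : nat := (\sum_(d <- divisors n) d)%N.

Definition perfect (n : nat) : bool := ((0 < n) && (sigma n == 2 * n))%N.

(* Only meaningful for real s > 1, where the series converges;
   riemannR s k = 1 / (k + 1) `^ s, so the terms start at k + 1 = 1. *)
Definition zeta (R : realType) (s : R) : R := limn (series (riemannR s)).

(* Main.v *)
Require Import Defs.
From mathcomp Require Import all_boot all_order all_algebra.
From mathcomp Require Import all_classical all_reals all_analysis.
From mathcomp Require Import ring lra.
Import Order.TTheory GRing.Theory Num.Theory.
Import numFieldNormedType.Exports.
Local Open Scope ring_scope.

(** Write S_p(a) = 1 + p^-1 + ... + p^-a = (1 - p^-(a+1)) / (1 - p^-1), and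
    h_p for the exponent of p in n. Since sigma is multiplicative, perfection
    of n says that the product of the S_p(h_p) over p | n equals 2
    ([perfect_prod_inv]). Both bounds compare S_p(alpha) with this identity.

    Upper bound. S_p is increasing and alpha <= h_p, so the product is at most
    2, with equality only if every h_p equals alpha. That is excluded for an
    odd perfect number ([odd_perfect_exponents_not_constant]): sigma n = 2 n is
    exactly once divisible by 2, whereas the factors 1 + p + ... + p^alpha of
    sigma n all have the parity of alpha + 1. They cannot all be odd, and if
    they are all even there is only one of them; but a power of an odd prime
    is not perfect ([sum_powers_lt_double]).

    Lower bound. Put s = alpha + 1, let D be the product of the 1 - p^-s and E
    the product of the 1 / (1 - p^-1), over p | n. The product to be bounded is
    D E, and E > 2 because S_p(h_p) < 1 / (1 - p^-1). As n is odd, 2 is a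
    further prime, and the finite Euler product over 2 and the primes of n is at
    most zeta s ([euler_product_le_zeta]):
      1 / ((1 - 2^-s) D) <= zeta s.
    Hence D E > 2 D >= 2 / (zeta s (1 - 2^-s)), which is the claimed bound.

    The expansion of a sum over divisors as a product over primes
    ([sum_divisors_prod]) serves twice: with f d = d for sigma, and with
    f d = d^-s for the Euler product. *)

(** * Sums over divisors as products over primes *)

(** Each divisor of p^h m is p^i d for a unique i <= h and a unique d | m,
    because p does not divide m. *)
Lemma perm_divisors_prime_powerM (p h m : nat) : prime p -> (0 < m)%N -> ~~ (p %| m)%N ->
  perm_eq (divisors (p ^ h * m)) [seq (p ^ i * d)%N | i <- iota 0 h.+1, d <- divisors m].
Proof.
move=> p_pr m_gt0 pNm; have p_gt0 := prime_gt0 p_pr.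
have pNd d : (d %| m)%N -> (0 < d)%N /\ logn p d = 0%N.
  move=> dm; split; first exact: dvdn_gt0 dm.
  by rewrite lognE; case: and3P => // -[_ _ /dvdn_trans/(_ dm) pm]; rewrite pm in pNm.
apply: uniq_perm; first exact: divisors_uniq.
  apply: allpairs_uniq; [exact: iota_uniq|exact: divisors_uniq|].
  move=> x y
    /allpairsP[[i d] [_ dm ->]] /allpairsP[[j e] [_ em ->]] /= E.
  move: dm em; rewrite /= -!dvdn_divisors // => /pNd[d0 ld] /pNd[e0 le].
  have := congr1 (logn p) E; rewrite !lognM ?expn_gt0 ?p_gt0 //.
  rewrite !pfactorK // ld le !addn0 => ij; rewrite ij in E *.
  by move/eqP: E; rewrite eqn_pmul2l ?expn_gt0 ?p_gt0 // => /eqP ->.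
move=> d; rewrite -dvdn_divisors ?muln_gt0 ?expn_gt0 ?p_gt0 //.
apply/idP/allpairsP => [dpm|[[i e] []]]; last first.
  rewrite mem_iota -dvdn_divisors //= => ih em ->.
  by rewrite dvdn_mul // dvdn_exp2l.
have d_gt0 : (0 < d)%N by apply: dvdn_gt0 dpm; rewrite muln_gt0 expn_gt0 p_gt0.
have [e pNe dE] := pfactor_coprime p_pr d_gt0.
exists (logn p d, e); split.
- rewrite mem_iota ltnS.
  have := dvdn_leq_log p _ dpm.
  rewrite lognM ?expn_gt0 ?p_gt0 // pfactorK // (pNd m _).2 // addn0; apply.
  by rewrite muln_gt0 expn_gt0 p_gt0.
- rewrite -dvdn_divisors // -(@Gauss_dvdr _ (p ^ h)); last first.
    by rewrite coprime_sym coprimeXl.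
  by apply: dvdn_trans dpm; rewrite [X in (_ %| X)%N]dE dvdn_mulr.
- by rewrite mulnC.
Qed.

(** Stated for an arbitrary list of primes with arbitrary exponents rather
    than for the factorization of a given integer: the Euler product needs all
    exponents equal to some H that tends to infinity. *)
Lemma sum_divisors_prod (A : comPzSemiRingType) (f : nat -> A)
    (ps : seq nat) (h : nat -> nat) :
  f 1%N = 1 -> {morph f : a b / (a * b)%N >-> a * b} ->
  uniq ps -> all prime ps ->
  \sum_(d <- divisors (\prod_(p <- ps) p ^ h p)%N) f d
    = \prod_(p <- ps) \sum_(0 <= i < (h p).+1) f p ^+ i.
Proof.
move=> f1 fM; have fX p i : f (p ^ i)%N = f p ^+ i.
  by elim: i => [|i IH]; rewrite ?expn0 ?expr0 // expnS exprS fM IH.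
elim: ps => [|p ps IH] /=; first by rewrite !big_nil big_seq1 f1.
case/andP => pNps ups /andP[p_pr ps_pr].
have m_gt0 : (0 < \prod_(q <- ps) q ^ h q)%N.
  rewrite big_seq; elim/big_rec: _ => // q m /(allP ps_pr) /prime_gt0 q0 m0.
  by rewrite muln_gt0 expn_gt0 q0.
have pNm : ~~ (p %| \prod_(q <- ps) q ^ h q)%N.
  rewrite big_seq; elim/big_rec: _ => [|q m qps IHm].
    by rewrite dvdn1 gtn_eqF // prime_gt1.
  rewrite Euclid_dvdM // (negPf IHm) orbF Euclid_dvdX //.
  rewrite dvdn_prime2 ?(allP ps_pr _ qps) //.
  by apply: contra pNps => /andP[/eqP -> _].
rewrite [RHS]big_cons [X in divisors X]big_cons.
rewrite (perm_big _ (perm_divisors_prime_powerM p (h p) _ p_pr m_gt0 pNm)).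
rewrite -(IH ups ps_pr) big_allpairs_dep mulr_suml /=.
by apply: eq_bigr => i _; rewrite mulr_sumr; apply: eq_bigr => d _; rewrite fM fX.
Qed.

Lemma sigma_prod (n : nat) : (0 < n)%N ->
  sigma n = (\prod_(p <- primes n) \sum_(0 <= i < (logn p n).+1) p ^ i)%N.
Proof.
move=> n_gt0; have ps_pr : all prime (primes n).
  by apply/allP => p; rewrite mem_primes => /and3P[].
have := sum_divisors_prod nat id (primes n) (logn^~ n) erefl (fun a b => erefl)
  (primes_uniq n) ps_pr.
have -> : (\prod_(p <- primes n) p ^ logn p n)%N = n.
  by rewrite [RHS]prod_prime_decomp // prime_decompE big_map.
rewrite /sigma => E; rewrite [LHS]E.
by apply: eq_bigr => p _; apply: eq_bigr => i _; rewrite natrXE.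
Qed.

(** * Exponents of an odd perfect number *)

Lemma odd_sum_powers (p m : nat) : odd p -> odd (\sum_(0 <= i < m) p ^ i)%N = odd m.
Proof.
move=> p_odd; elim: m => [|m IH]; first by rewrite big_nil.
by rewrite big_nat_recr //= oddD IH oddX p_odd orbT addbT.
Qed.

(** A power of a prime p > 2 is deficient, since sigma (p^h) / p^h stays below
    p / (p - 1) <= 3 / 2. *)
Lemma sum_powers_lt_double (p h : nat) : (2 < p)%N ->
  (\sum_(0 <= i < h.+1) p ^ i < 2 * p ^ h)%N.
Proof.
move=> p_gt2; have p_gt0 : (0 < p)%N by apply: leq_trans p_gt2.
elim: h => [|h IH]; first by rewrite big_nat1 expn0.
rewrite big_nat_recr //= mul2n -addnn ltn_add2r (leq_trans IH) //.
by rewrite expnS leq_mul2r (ltnW p_gt2) orbT.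
Qed.

(** A weak form of Euler's theorem that an odd perfect number has exactly one
    odd exponent: constant exponents are ruled out by counting the factors 2
    in sigma n = 2 n. *)
Lemma odd_perfect_exponents_not_constant (n a : nat) : odd n -> perfect n ->
  exists2 p, p \in primes n & logn p n != a.
Proof.
move=> n_odd /andP[n_gt0 /eqP nE]; apply/hasP; apply/negPn/negP => /hasPn ha.
have {}ha p : p \in primes n -> logn p n = a by move=> /ha; rewrite negbK => /eqP.
have sE : (2 * n = \prod_(p <- primes n) \sum_(0 <= i < a.+1) p ^ i)%N.
  rewrite -nE sigma_prod // big_seq [RHS]big_seq.
  by apply: eq_bigr => p /ha ->.
have nprod : n = (\prod_(p <- primes n) p ^ a)%N.
  rewrite [LHS]prod_prime_decomp // prime_decompE big_map /= big_seq [RHS]big_seq.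
  by apply: eq_bigr => p /ha ->.
have p_odd p : p \in primes n -> odd p.
  by rewrite mem_primes => /and3P[_ _ /dvdn_odd]; exact.
have factor_odd p : p \in primes n -> odd (\sum_(0 <= i < a.+1) p ^ i)%N = ~~ odd a.
  by move=> /p_odd /odd_sum_powers ->.
(* If a is even, sigma n is a product of odd numbers, yet equals 2 n. *)
case: (boolP (odd a)) => [a_odd|a_even]; last first.
  have : odd (2 * n).
    rewrite sE big_seq; elim/big_rec: _ => // p m /factor_odd pm m_odd.
    by rewrite oddM pm a_even.
  by rewrite oddM.
have p_pr p : p \in primes n -> prime p by rewrite mem_primes => /and3P[].
case: (primes n) => [|p [|q ps]] in sE nprod p_odd p_pr factor_odd *.
- by have := congr1 odd sE; rewrite big_nil oddM.
- have pin : p \in [:: p] by rewrite mem_head.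
  have p_gt2 : (2 < p)%N by rewrite odd_prime_gt2 ?p_odd ?p_pr.
  have := sum_powers_lt_double p a p_gt2.
  by move: sE nprod; rewrite !big_seq1 => <- <-; rewrite ltnn.
(* Two even factors make 2 n divisible by 4. *)
- pose S r := (\sum_(0 <= i < a.+1) r ^ i)%N.
  have S_even r : r \in [:: p, q & ps] -> exists k, S r = (2 * k)%N.
    move=> /factor_odd Sr; exists (S r)./2.
    by rewrite mul2n even_halfK // Sr a_odd.
  have [k pk] := S_even p (mem_head _ _).
  have [l ql] : exists l, S q = (2 * l)%N by apply: S_even; rewrite !inE eqxx orbT.
  have : (2 * n = S p * (S q * \prod_(r <- ps) S r))%N.
    by rewrite sE big_cons; congr (_ * _)%N; rewrite big_cons.
  rewrite pk ql -!mulnA => /eqP; rewrite eqn_pmul2l // => /eqP/(congr1 odd).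
  by rewrite n_odd !oddM /= andbF.
Qed.

(** * Comparison of products and geometric sums *)

Lemma ltr_prod_seq_exists (R : numDomainType) (I : eqType) (r : seq I) (E1 E2 : I -> R) :
  {in r, forall i, 0 < E1 i <= E2 i} -> (exists2 i, i \in r & E1 i < E2 i) ->
  \prod_(i <- r) E1 i < \prod_(i <- r) E2 i.
Proof.
elim: r => [_ [] //|a r IH Ele [i]].
have /andP[a0 ale] := Ele a (mem_head _ _).
have {}Ele : {in r, forall i, 0 < E1 i <= E2 i}.
  by move=> j jr; apply: Ele; rewrite inE jr orbT.
have r1_gt0 : 0 < \prod_(i <- r) E1 i by rewrite big_seq prodr_gt0 // => j /Ele /andP[].
have r_le : \prod_(i <- r) E1 i <= \prod_(i <- r) E2 i.
  by rewrite !(big_seq _ _ r) ler_prod // => j /Ele /andP[/ltW -> ->].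
rewrite inE !big_cons => /predU1P[-> alt|ir ilt].
  rewrite (lt_le_trans (y := E2 a * \prod_(j <- r) E1 j)) ?ltr_pM2r ?ler_pM2l //.
  exact: lt_trans a0 alt.
rewrite (lt_le_trans (y := E1 a * \prod_(j <- r) E2 j)) ?ltr_pM2l ?IH //.
  by exists i.
by rewrite ler_wpM2r // (le_trans (ltW r1_gt0)).
Qed.

Lemma inv_nat_itv (R : realFieldType) (p : nat) : (1 < p)%N -> 0 < (p%:R^-1 : R) < 1.
Proof.
by move=> p1; rewrite invr_gt0 ltr0n (ltnW p1) invf_lt1 ?ltr0n ?ltr1n // (ltnW p1).
Qed.

Lemma geometric_sumE (F : realFieldType) (x : F) (m : nat) : 0 < x < 1 ->
  \sum_(0 <= i < m) x ^+ i = (1 - x ^+ m) * (1 - x)^-1.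
Proof.
move=> /andP[_ x1]; have nz : 1 - x != 0 by rewrite subr_eq0 gt_eqF.
by apply: (mulIf nz); rewrite mulfVK // -opprB -[1 - _]opprB subrX1 mulrN big_mkord mulrC.
Qed.

(** * Finite Euler products and the zeta function *)

Lemma nondecreasing_series_riemannR (R : realType) (a : R) : 0 <= a ->
  {homo series (riemannR a) : m n / (m <= n)%N >-> m <= n}.
Proof.
move=> a_ge0; apply/nondecreasing_seqP => k.
by rewrite !seriesEnat /= big_nat_recr //= lerDl ltW // riemannR_gt0.
Qed.

(** The k-th partial sum is at most 2 - 1/k, by telescoping
    1/(k+1)^s <= 1/(k+1)^2 <= 1/k - 1/(k+1). *)
Lemma cvg_series_riemannR (R : realType) (s : nat) : (1 < s)%N ->
  cvgn (series (riemannR (s%:R : R))).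
Proof.
move=> s_gt1; apply: nondecreasing_is_cvgn.
  exact: nondecreasing_series_riemannR.
exists 2 => _ [k _ <-]; rewrite seriesEnat /=.
suff : \sum_(0 <= i < k) riemannR (s%:R : R) i <= 2 - (k%:R)^-1 \/ k = 0%N.
  by case=> [/le_trans->//|->]; rewrite ?big_nil // lerBlDl lerDr invr_ge0.
elim: k => [|k [IH|->]]; first by right.
  left; case: k IH => [|k] IH.
    by rewrite big_nat1 /riemannR powR1 !invr1; lra.
  rewrite big_nat_recr //=.
  have k_gt0 : 0 < k.+1%:R :> R by rewrite ltr0n.
  have term_le : riemannR (s%:R : R) k.+1 <= k.+1%:R^-1 - k.+2%:R^-1.
    rewrite /riemannR powR_mulrn // (le_trans (y := (k.+2%:R ^+ 2)^-1)) //.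
      rewrite lef_pV2 ?posrE ?exprn_gt0 ?ltr0n // ler_weXn2l // ler1n //.
    rewrite -[k.+2%:R]natr1 -subr_ge0.
    have -> : k.+1%:R^-1 - (k.+1%:R + 1)^-1 - ((k.+1%:R + 1) ^+ 2)^-1
      = (k.+1%:R * (k.+1%:R + 1) ^+ 2)^-1 :> R by field; rewrite ?gt_eqF // addr_gt0.
    by rewrite invr_ge0 mulr_ge0 // sqr_ge0.
  by apply: (le_trans (lerD IH term_le)); rewrite addrA subrK.
by left; rewrite big_nat1 /riemannR powR1 !invr1; lra.
Qed.

(** The divisors of N are distinct integers between 1 and N, so the sum is
    part of the N-th partial sum of the zeta series. *)
Lemma sum_divisors_le_zeta (R : realType) (s N : nat) : (1 < s)%N -> (0 < N)%N ->
  \sum_(d <- divisors N) (d%:R^-1 : R) ^+ s <= zeta (s%:R : R).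
Proof.
move=> s_gt1 N_gt0.
have dE : perm_eq (divisors N) [seq d <- index_iota 1 N.+1 | (d %| N)%N].
  apply: uniq_perm; rewrite ?divisors_uniq ?filter_uniq ?iota_uniq // => d.
  rewrite -dvdn_divisors // mem_filter mem_index_iota ltnS.
  by case: (boolP (d %| N)%N) => //= dN; rewrite (dvdn_gt0 N_gt0) // dvdn_leq.
rewrite (perm_big _ dE) big_filter big_mkcond /= big_add1 /=.
apply: le_trans (nondecreasing_cvgn_le _ (cvg_series_riemannR R s s_gt1) N); last first.
  exact: nondecreasing_series_riemannR.
rewrite seriesEnat /=; apply: ler_sum => i _.
rewrite /riemannR powR_mulrn // exprVn.
by case: ifP => // _; rewrite invr_ge0 exprn_ge0.
Qed.

(** Truncating each geometric series 1 / (1 - p^-s) at the exponent H turns the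
    product into the sum of d^-s over the divisors d of the product of the
    p^H, hence into something at most zeta s; then H tends to infinity. *)
Lemma euler_product_le_zeta (R : realType) (s : nat) (ps : seq nat) :
  (1 < s)%N -> uniq ps -> all prime ps ->
  \prod_(p <- ps) (1 - (p%:R^-1 : R) ^+ s)^-1 <= zeta (s%:R : R).
Proof.
move=> s_gt1 ps_uniq /allP ps_pr.
pose x p := (p%:R^-1 : R) ^+ s.
have xX p : prime p -> `|x p| < 1.
  move=> p_pr; have /andP[p0 p1] := inv_nat_itv R p (prime_gt1 p_pr).
  by rewrite ger0_norm ?exprn_ge0 ?ltW // exprn_ilt1 ?(ltW p0) // -lt0n ltnW.
have cvgx : ((\prod_(p <- ps) \sum_(0 <= i < H.+1) x p ^+ i) @[H --> \oo]
    --> \prod_(p <- ps) (1 - x p)^-1)%classic.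
  elim: ps ps_pr {ps_uniq} => [|p ps IH] ps_pr.
    rewrite big_nil; under eq_fun do rewrite big_nil; exact: cvg_cst.
  rewrite big_cons; under eq_fun do rewrite big_cons.
  apply: cvgM; last by apply: IH => q qps; apply: ps_pr; rewrite inE qps orbT.
  have -> : (fun H => \sum_(0 <= i < H.+1) x p ^+ i)
      = (fun H => series (geometric 1 (x p)) H.+1).
    by apply: funext => H; rewrite seriesEnat; apply: eq_bigr => i _; rewrite /= mul1r.
  rewrite (cvg_shiftS (series (geometric 1 (x p)))) -div1r.
  exact/cvg_geometric_series/xX/ps_pr/mem_head.
rewrite -(cvg_lim (@Rhausdorff R) cvgx); apply: limr_le.
  by apply/cvg_ex; eexists; exact: cvgx.
apply: nearW => H.
rewrite -(sum_divisors_prod R x ps (fun=> H)) //; last 1 first.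
- exact/allP.
- apply: sum_divisors_le_zeta => //.
  rewrite big_seq; elim/big_rec: _ => // q m /ps_pr /prime_gt0 q0 m0.
  by rewrite muln_gt0 expn_gt0 q0.
- by rewrite /x invr1 expr1n.
- by move=> a b; rewrite /x natrM invfM exprMn.
Qed.

(** * Bounds for odd perfect numbers *)

(** This is sigma n / n = 2, where each factor sigma (p^h) / p^h is read
    backwards as a sum of negative powers. *)
Lemma perfect_prod_inv (R : numFieldType) (n : nat) : perfect n ->
  \prod_(p <- primes n) \sum_(0 <= i < (logn p n).+1) (p%:R^-1 : R) ^+ i = 2.
Proof.
case/andP=> n_gt0 /eqP nE.
have n_neq0 : n%:R != 0 :> R by rewrite pnatr_eq0 -lt0n.
have nX : n%:R = \prod_(p <- primes n) p%:R ^+ logn p n :> R.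
  rewrite [X in X%:R](prod_prime_decomp n_gt0) prime_decompE big_map natr_prod.
  by apply: eq_bigr => p _; rewrite natrX.
apply: (mulIf n_neq0); rewrite -natrM -nE sigma_prod // natr_prod.
rewrite [X in _ * X]nX -big_split /=.
rewrite big_seq [RHS]big_seq; apply: eq_bigr => p; rewrite mem_primes => /and3P[p_pr _ _].
have p0 : p%:R != 0 :> R by rewrite pnatr_eq0 -lt0n prime_gt0.
rewrite natr_sum [RHS]big_nat_rev /= mulr_suml !big_nat; apply: eq_bigr => i /andP[_ ih].
by rewrite add0n subSS !natrX expfB_cond ?(negPf p0) // exprVn mulrC.
Qed.

Theorem theorem3p1 (R : realType) (n alpha : nat)
    (n_odd : odd n) (n_perfect : perfect n)
    (alpha_gt0 : (0 < alpha)%N)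
    (alpha_le : forall p : nat, prime p -> (p %| n)%N -> (alpha <= logn p n)%N) :
  2 ^+ (alpha + 2) / (zeta ((alpha + 1)%:R : R) * (2 ^+ (alpha + 1) - 1))
    < \prod_(p <- primes n) \sum_(0 <= i < alpha.+1) (p%:R : R) ^- i
    < 2.
Proof.
have n_gt0 : (0 < n)%N by case/andP: n_perfect.
have p_pr p : p \in primes n -> prime p by rewrite mem_primes => /and3P[].
have p_itv p : p \in primes n -> 0 < (p%:R^-1 : R) < 1.
  by move=> /p_pr /prime_gt1; exact: inv_nat_itv.
rewrite (eq_bigr (fun p => \sum_(0 <= i < alpha.+1) (p%:R^-1 : R) ^+ i)); last first.
  by move=> p _; apply: eq_bigr => i _; rewrite exprVn.
have alpha_leq p : p \in primes n -> (alpha <= logn p n)%N.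
  by rewrite mem_primes => /and3P[/alpha_le + _ pn]; apply.
(* This prime makes the upper bound strict. *)
have [q q_in q_neq] := odd_perfect_exponents_not_constant n alpha n_odd n_perfect.
have one_sub_gt0 m p : p \in primes n -> 0 < 1 - (p%:R^-1 : R) ^+ m.+1.
  by move=> /p_itv /andP[p0 p1]; rewrite subr_gt0 exprn_ilt1 // ltW.
have sum_lt p a b : p \in primes n -> (a < b)%N ->
    \sum_(0 <= i < a.+1) (p%:R^-1 : R) ^+ i < \sum_(0 <= i < b.+1) (p%:R^-1 : R) ^+ i.
  move=> pn ab; have /andP[p0 p1] := p_itv p pn.
  rewrite !geometric_sumE ?p_itv // ltr_pM2r ?invr_gt0 ?subr_gt0 //.
  by rewrite ltrD2l ltrN2 ltr_iXn2l.
have sum_gt0 p a : p \in primes n -> 0 < \sum_(0 <= i < a.+1) (p%:R^-1 : R) ^+ i.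
  move=> pn; rewrite geometric_sumE ?p_itv // mulr_gt0 ?one_sub_gt0 // invr_gt0.
  by rewrite -[X in 1 - X]expr1 one_sub_gt0.
apply/andP; split; last first.
  rewrite -[X in _ < X](perfect_prod_inv R n n_perfect).
  apply: ltr_prod_seq_exists => [p pn|].
    have := alpha_leq p pn.
    by rewrite sum_gt0 //= leq_eqVlt => /predU1P[->//|/(sum_lt p _ _ pn)/ltW].
  exists q => //; apply: sum_lt => //.
  by rewrite ltn_neqAle eq_sym q_neq alpha_leq.
set s := alpha.+1.
pose D := \prod_(p <- primes n) (1 - (p%:R^-1 : R) ^+ s).
pose E := \prod_(p <- primes n) (1 - (p%:R^-1 : R))^-1.
have D_gt0 : 0 < D by rewrite /D big_seq prodr_gt0 // => p; exact: one_sub_gt0.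
have -> : \prod_(p <- primes n) \sum_(0 <= i < s) (p%:R^-1 : R) ^+ i = D * E.
  rewrite /D /E -big_split big_seq [RHS]big_seq; apply: eq_bigr => p pn.
  by rewrite geometric_sumE ?p_itv.
have E_gt2 : 2 < E.
  rewrite -(perfect_prod_inv R n n_perfect).
  have lt_inv p : p \in primes n ->
      \sum_(0 <= i < (logn p n).+1) (p%:R^-1 : R) ^+ i < (1 - (p%:R^-1 : R))^-1.
    move=> pn; have /andP[p0 p1] := p_itv p pn.
    rewrite geometric_sumE ?p_itv // gtr_pMl ?invr_gt0 ?subr_gt0 //.
    by rewrite gtrDl oppr_lt0 exprn_gt0.
  apply: ltr_prod_seq_exists => [p pn|]; last by exists q => //; exact: lt_inv.
  by rewrite sum_gt0 //= ltW // lt_inv.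
have ps_uniq : uniq (2%N :: primes n).
  rewrite /= primes_uniq andbT mem_primes n_gt0 dvdn2 n_odd //.
have ps_pr : all prime (2%N :: primes n) by rewrite /=; apply/allP.
have := euler_product_le_zeta R s _ (alpha_gt0 : (1 < s)%N) ps_uniq ps_pr.
rewrite big_cons prodfV -/D addn1 addn2 -/s.
set z := zeta _ => z_ge.
have w_gt0 : 0 < 1 - (2%:R^-1 : R) ^+ s.
  by have /andP[? ?] := inv_nat_itv R 2 isT; rewrite subr_gt0 exprn_ilt1 // ltW.
have z_gt0 : 0 < z by apply: lt_le_trans z_ge; rewrite mulr_gt0 // invr_gt0.
have X_gt0 : 0 < (2 : R) ^+ s by rewrite exprn_gt0.
have -> : 2 ^+ alpha.+2 / (z * (2 ^+ s - 1)) = 2 * (z * (1 - (2%:R^-1 : R) ^+ s))^-1.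
  rewrite exprS -/s exprVn.
  have -> : 2 ^+ s - 1 = 2 ^+ s * (1 - (2 ^+ s)^-1) :> R.
    by rewrite mulrBr mulr1 divff // gt_eqF.
  by rewrite mulrCA invfM mulrA mulfK // gt_eqF.
apply: (@le_lt_trans _ _ (2 * D)); last by rewrite mulrC ltr_pM2l.
rewrite ler_pM2l // -[D]invrK lef_pV2 ?posrE ?invr_gt0 ?mulr_gt0 //.
by rewrite -ler_pdivrMr // mulrC.
Qed.
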